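(* Let $p\ge 1$, let $(\mathcal{N},\mathcal{I})$ be a $p$-set system with $|\mathcal{N}|=n$ and rank $r$, let $f:2^{\mathcal{N}}\to\mathbb{R}$ be a non-monotone, non-negative submodular function, and let $\epsilon\in(0,1)$. Then the deterministic algorithm TwinGreedyFast (described in the context), run on $(\mathcal{N},\mathcal{I},f,\epsilon)$, returns a solution $S^*\in\mathcal{I}$ with $\frac{1}{2p+2}-\epsilon$ approximation ratio for the problem $\max\{f(S):S\in\mathcal{I}\}$, i.e. $f(S^* )\ge\left(\frac{1}{2p+2}-\epsilon\right)\max\{f(S):S\in\mathcal{I}\}$, and its time complexity is $\mathcal{O}\left(\frac{n}{\epsilon}\log\frac{r}{\epsilon}\right)$.
   Context: Independence system: a finite ground set $\mathcal{N}$ and a family $\mathcal{I}\subseteq2^{\mathcal{N}}$ with $\emptyset\in\mathcal{I}$ and such that $A\subseteq B\in\mathcal{I}$ implies $A\in\mathcal{I}$. For $X\subseteq Y\subseteq\mathcal{N}$, $X$ is a base of $Y$ if $X\in\mathcal{I}$ and $X\cup\{x\}\notin\mathcal{I}$ for all $x\in Y\setminus X$. An independence system is a $p$-set system ($p\ge1$) if for every $Y\subseteq\mathcal{N}$ and any two bases $X_1,X_2$ of $Y$ we have $|X_1|\le p|X_2|$. Rank: $r=\max\{|S|:S\in\mathcal{I}\}\ge1$. Submodular: $f(X)+f(Y)\ge f(X\cup Y)+f(X\cap Y)$ for all $X,Y\subseteq\mathcal{N}$. Non-negative: $f(X)\ge 0$ for all $X$. Non-monotone: there exist $X\subset Y\subseteq\mathcal{N}$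 with $f(X)>f(Y)$. Marginal gain: $f(X\mid Y)=f(X\cup Y)-f(Y)$, and $f(x\mid Y)=f(\{x\}\mid Y)$; $f(e)=f(\{e\})$. Algorithm TwinGreedyFast: let $\tau_{\max}=\max\{f(e):e\in\mathcal{N},\{e\}\in\mathcal{I}\}$ and $S_1=S_2=\emptyset$. For $\tau=\tau_{\max},\ \tau_{\max}/(1+\epsilon),\ \tau_{\max}/(1+\epsilon)^2,\dots$, as long as $\tau>\epsilon\tau_{\max}/[r(1+\epsilon)]$, do the following: go through the elements $e\in\mathcal{N}\setminus(S_1\cup S_2)$ one by one in arbitrary order; for each such $e$ set, for $j\in\{1,2\}$, $\Delta_j=f(e\mid S_j)$ if $S_j\cup\{e\}\in\mathcal{I}$ and $\Delta_j=-\infty$ otherwise (with the current $S_1,S_2$); let $i\in\arg\max_{j\in\{1,2\}}\Delta_j$ (ties broken arbitrarily); if $\Delta_i\ge\tau$, replace $S_i$ by $S_i\cup\{e\}$. At the end return $S^*\in\arg\max_{X\in\{S_1,S_2\}}f(X)$. Time complexity is measured with $f$ and membership in $\mathcal{I}$ given by oracles, each evaluation of $f$ and each test of membership in $\mathcal{I}$ counting as one step; $\mathcal{O}(\cdot)$ hides an absolute constant and is understood for $r/\epsilon$ bounded away from $1$ (say $r/\epsilon\ge 2$). *)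

(* Defs.v *)
(* MathComp / MathComp-Analysis development. *)
From HB Require Import structures.
From mathcomp Require Import all_boot all_order all_algebra.
From mathcomp Require Import reals constructive_ereal exp.

Set Implicit Arguments.
Unset Strict Implicit.
Unset Printing Implicit Defensive.

Import Order.TTheory GRing.Theory Num.Theory.
Local Open Scope ring_scope.

Definition independence_system (N : finType) (I : {set {set N}}) : Prop :=
  set0 \in I /\ forall A B : {set N}, A \subset B -> B \in I -> A \in I.

Definition is_base (N : finType) (I : {set {set N}}) (X Y : {set N}) : bool :=
  [&& X \subset Y, X \in I & [forall x in Y :\: X, x |: X \notin I]].

Definition p_set_system (R : realType) (N : finType) (p : R)
    (I : {set {set N}}) : Prop :=
  independence_system I /\
  forall Y X1 X2 : {set N}, is_base I X1 Y -> is_base I X2 Y ->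
    #|X1|%:R <= p * #|X2|%:R.

Definition rank (N : finType) (I : {set {set N}}) : nat :=
  \max_(S in I) #|S|.

Definition submodular (R : realType) (N : finType) (f : {set N} -> R) : Prop :=
  forall X Y : {set N}, f (X :|: Y) + f (X :&: Y) <= f X + f Y.

Definition non_negative (R : realType) (N : finType) (f : {set N} -> R) : Prop :=
  forall X : {set N}, 0 <= f X.

Definition non_monotone (R : realType) (N : finType) (f : {set N} -> R) : Prop :=
  exists X Y : {set N}, X \proper Y /\ f Y < f X.

(* The initial value is attained, since set0 is independent. *)
Definition opt (R : realType) (N : finType) (I : {set {set N}})
    (f : {set N} -> R) : R :=
  \big[Num.max/f set0]_(S in I) f S.

(* Programs that access the objective function and the independence system
   only through the two queries EvalF and TestI. *)
Inductive prog (R : Type) (N : finType) : Type -> Type :=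
| Ret (A : Type) of A : prog R N A
| Bind (A B : Type) of prog R N A & (A -> prog R N B) : prog R N B
| EvalF of {set N} : prog R N R
| TestI of {set N} : prog R N bool
| While (A : Type) of (A -> bool) & (A -> prog R N A) & A : prog R N A.

Arguments Ret {R N A}.
Arguments Bind {R N A B}.
Arguments EvalF {R N}.
Arguments TestI {R N}.
Arguments While {R N A}.

Notation "'let!' x := m 'in' k" := (Bind m (fun x => k))
  (at level 200, x name, m at level 200, k at level 200).

(* Evaluation with a cap [fuel] on the number of iterations of each while loop.
   The result is [Some (a, t)] if the program returns [a] after exactly [t]
   oracle queries, and [None] if the cap is exceeded. *)
Fixpoint run (R : Type) (N : finType) (f : {set N} -> R) (I : {set {set N}})
    (fuel : nat) (A : Type) (m : prog R N A) {struct m} : option (A * nat) :=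
  match m in prog _ _ T return option (T * nat) with
  | Ret _ a => Some (a, 0%N)
  | Bind _ _ m1 m2 =>
      if run f I fuel m1 is Some (a, t1) then
        if run f I fuel (m2 a) is Some (b, t2) then Some (b, (t1 + t2)%N)
        else None
      else None
  | EvalF X => Some (f X, 1%N)
  | TestI X => Some (X \in I, 1%N)
  | While _ guard body a0 =>
      (fix loop (i : nat) a t :=
         if guard a then
           if i is i'.+1 then
             if run f I fuel (body a) is Some (a', t') then
               loop i' a' (t + t')%N
             else None
           else None
         else Some (a, t)) fuel a0 0%N
  end.

Definition returns (R : Type) (N : finType) (f : {set N} -> R)
    (I : {set {set N}}) (A : Type) (m : prog R N A) (a : A) (t : nat) : Prop :=
  exists fuel, run f I fuel m = Some (a, t).

Lemma run_mono (R : Type) (N : finType) (f : {set N} -> R) (I : {set {set N}})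
    (k l : nat) (A : Type) (m : prog R N A) (x : A * nat) :
  (k <= l)%N -> run f I k m = Some x -> run f I l m = Some x.
Proof.
move=> le_kl; elim: m x => {A} [A a|A B m1 IH1 m2 IH2|X|X|A g b IH a0] x //=.
  case E1: (run f I k m1) => [[a t1]|] //; rewrite (IH1 _ E1).
  by case E2: (run f I k (m2 a)) => [[c t2]|] //; rewrite (IH2 _ _ E2).
elim: {1 3}(k) {1 3}(l) (le_kl) a0 0%N => [|i IHi] [|j] //= le_ij a t;
  case: (g a) => //.
case E: (run f I _ (b a)) => [[a' t']|] //.
by rewrite (IH _ _ E); apply: IHi.
Qed.

Lemma returns_unique (R : Type) (N : finType) (f : {set N} -> R)
    (I : {set {set N}}) (A : Type) (m : prog R N A) (a b : A) (t u : nat) :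
  returns f I m a t -> returns f I m b u -> (a, t) = (b, u).
Proof.
move=> [k Ek] [l El].
have := run_mono (leq_maxl k l) Ek.
by rewrite (run_mono (leq_maxr k l) El) => -[-> ->].
Qed.

Fixpoint for_each (R : Type) (N : finType) (X A : Type) (s : seq X)
    (body : X -> A -> prog R N A) (a : A) : prog R N A :=
  if s is x :: s' then let! a' := body x a in for_each s' body a' else Ret a.

(* All the arbitrary choices made during one execution. [scan_order k] lists the
   whole ground set; round k visits the elements not yet selected, in that
   order. An element is examined at most once per round, so [tie k e] is a free
   choice for each comparison of gains. A tie is resolved in favour of the
   first set when the flag is true. *)
Record choices (N : finType) := Choices {
  scan_order : nat -> seq N;
  tie : nat -> N -> bool;
  final_tie : bool
}.

Definition valid_choices (N : finType) (c : choices N) : Prop :=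
  forall k : nat, perm_eq (scan_order c k) (enum N).

(* Starting the maximum from 0 is harmless for a non-negative f. *)
Definition max_singleton (R : realType) (N : finType) : prog R N R :=
  for_each (enum N) (fun (e : N) (m : R) =>
    let! b := TestI [set e] in
    if b then let! v := EvalF [set e] in Ret (Num.max m v) else Ret m) 0.

Definition gain (R : realType) (N : finType) (e : N) (S : {set N})
    : prog R N (\bar R) :=
  let! b := TestI (e |: S) in
  if b then
    let! v := EvalF (e |: S) in let! w := EvalF S in Ret (v - w)%:E
  else Ret -oo%E.

Definition examine (R : realType) (N : finType) (tau : R) (tie : N -> bool)
    (e : N) (S : {set N} * {set N}) : prog R N ({set N} * {set N}) :=
  let! d1 := gain R e S.1 in
  let! d2 := gain R e S.2 in
  let first := (d2 < d1)%E || ((d1 == d2) && tie e) in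
  Ret (if (tau%:E <= if first then d1 else d2)%E then
         if first then (e |: S.1, S.2) else (S.1, e |: S.2)
       else S).

(* A loop state (k, (S1, S2)) stands for the threshold
   tau = tau_max / (1 + eps) ^ k and the two current sets. *)
Definition TwinGreedyFast (R : realType) (N : finType) (r : nat) (eps : R)
    (c : choices N) : prog R N {set N} :=
  let! tmax := max_singleton R N in
  let tau k := tmax / (1 + eps) ^+ k in
  let! st :=
    While (fun st : nat * ({set N} * {set N}) =>
             eps * tmax / (r%:R * (1 + eps)) < tau st.1)
      (fun st =>
         let: (k, T) := st in
         let! T' := for_each [seq e <- scan_order c k | e \notin T.1 :|: T.2]
                      (examine (tau k) (tie c k)) T in
         Ret (k.+1, T'))
      (0%N, (set0, set0)) in
  let: (_, (S1, S2)) := st in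
  let! v1 := EvalF S1 in
  let! v2 := EvalF S2 in
  Ret (if (v2 < v1) || ((v1 == v2) && final_tie c) then S1 else S2).

(* Main.v *)
(** Fix an optimal independent set O. Since S1 and S2 are disjoint,
    submodularity gives f(O) <= f(O u S1) + f(O u S2), so it is enough to bound
    the marginal gains of the elements of O over S1 and over S2. An element e of
    O stops being addable to S1 for one of two reasons.
    - It was put into S2 while it could still join S1: its gain over S1 is at
      most the gain it brought to S2.
    - Adding some s to S1 blocked it: having been rejected in the previous
      round, it has gain at most (1 + eps) tau over S1, where tau is the current
      threshold and s gained at least tau. The p-set property bounds the number
      of blocked elements, at each moment, by p |S1|.
    As tau only decreases, a potential that credits the unused capacity
    p |S1| - |blocked| at the price (1 + eps) tau turns this charging into an
    invariant of the loop. An element that is never selected nor blocked has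
    gain at most eps tau_max / r, so at most eps f(O) is lost per S_j. *)
Require Import Defs.
From mathcomp Require Import all_boot all_order all_algebra.
From mathcomp Require Import reals constructive_ereal exp.
From mathcomp Require Import ring lra zify.

Import Order.TTheory GRing.Theory Num.Theory.
Local Open Scope ring_scope.

Set Implicit Arguments.
Unset Strict Implicit.
Unset Printing Implicit Defensive.

(** * Program logic for terminating runs with query counts *)

Section Exec.

Variables (R : realType) (N : finType) (f : {set N} -> R) (I : {set {set N}}).

(** Total correctness: the existence of a result includes termination of every loop, and by
    [returns_unique] the outcome described is the only one. *)
Definition exec A (m : prog R N A) (Q : A -> nat -> Prop) : Prop :=
  exists a t, returns f I m a t /\ Q a t.

Lemma exec_weaken A (m : prog R N A) (P Q : A -> nat -> Prop) :
  exec m P -> (forall a t, P a t -> Q a t) -> exec m Q.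
Proof. by move=> [a [t [ra Pa]]] PQ; exists a, t; split; [|apply: PQ]. Qed.

Lemma exec_ret A (a : A) (Q : A -> nat -> Prop) : Q a 0%N -> exec (Ret a) Q.
Proof. by move=> Qa; exists a, 0%N; split=> //; exists 0%N. Qed.

Lemma exec_eval X (Q : R -> nat -> Prop) : Q (f X) 1%N -> exec (EvalF X) Q.
Proof. by move=> Qa; exists (f X), 1%N; split=> //; exists 0%N. Qed.

Lemma exec_test X (Q : bool -> nat -> Prop) :
  Q (X \in I) 1%N -> exec (TestI X) Q.
Proof. by move=> Qa; exists (X \in I), 1%N; split=> //; exists 0%N. Qed.

Lemma exec_bind A B (m : prog R N A) (k : A -> prog R N B)
    (Q : B -> nat -> Prop) :
  exec m (fun a t => exec (k a) (fun b u => Q b (t + u)%N)) ->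
  exec (Bind m k) Q.
Proof.
move=> [a [t [[i ri] [b [u [[j rj] Qb]]]]]].
exists b, (t + u)%N; split=> //; exists (maxn i j) => /=.
by rewrite (run_mono (leq_maxl i j) ri) (run_mono (leq_maxr i j) rj).
Qed.

Lemma exec_for_each X A (body : X -> A -> prog R N A)
    (P : seq X -> A -> nat -> Prop) :
  (forall x s a t, P (x :: s) a t ->
     exec (body x a) (fun a' t' => P s a' (t + t')%N)) ->
  forall s a, P s a 0%N -> exec (for_each s body a) (P [::]).
Proof.
(* Writing the count as [0 + u] lets the induction start from an arbitrary number of queries already
   spent. *)
move=> step s a Pa; rewrite -[P [::]]/(fun b u => P [::] b (0 + u)%N).
elim: s a 0%N Pa => [|x s IH] a t Pa /=.
  by apply: exec_ret; rewrite addn0.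
apply: exec_bind; apply: exec_weaken (step _ _ _ _ Pa) _ => b u Pb.
by apply: exec_weaken (IH _ _ Pb) _ => c v; rewrite addnA.
Qed.

(** The variant [mu] bounds the number of iterations, hence the fuel that suffices. *)
Lemma exec_while A (guard : A -> bool) (body : A -> prog R N A)
    (P : A -> nat -> Prop) (mu : A -> nat) :
  (forall a t, P a t -> guard a ->
     exec (body a) (fun a' t' => P a' (t + t')%N /\ (mu a' < mu a)%N)) ->
  forall a, P a 0%N ->
  exec (While guard body a) (fun b u => P b u /\ ~~ guard b).
Proof.
(* [run] uses one number both as iteration counter and as fuel for the body, but only the counter
   decreases. The two are separated, and the induction produces a threshold [k] beyond which any
   values of both work. *)
move=> step a0 Pa0; pose loop fuel := fix loop i a t :=
  if guard a then
    if i is i'.+1 then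
      if run f I fuel (body a) is Some (a', t') then
        loop i' a' (t + t')%N
      else None
    else None
  else Some (a, t) : option (A * nat).
suff /(_ (mu a0).+1 a0 0%N (ltnSn _) Pa0) [k [b [u [loopE Pb gb]]]] :
    forall n a t, (mu a < n)%N -> P a t -> exists k b u,
      [/\ forall l i, (k <= l)%N -> (k <= i)%N -> loop l i a t = Some (b, u),
          P b u & ~~ guard b].
  exists b, u; split=> //; exists k.
  by rewrite -[LHS]/(loop k k a0 0%N) loopE.
elim=> [|n IH] // a t mua Pa; have [ga|nga] := boolP (guard a); last first.
  by exists 0%N, a, t; split=> // l [|i] _ _ /=; rewrite (negPf nga).
have [a' [t' [[j rj] [Pa' mua']]]] := step _ _ Pa ga.
have [|k [b [u [loopE Pb gb]]]] := IH a' (t + t')%N _ Pa'.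
  by apply: leq_trans mua' _; rewrite -ltnS.
exists (maxn j k.+1), b, u; split=> // l [|i].
  by move=> _; rewrite geq_max ltn0 andbF.
rewrite !geq_max => /andP[jl kl] /andP[_ ki] /=.
by rewrite ga (run_mono jl rj) loopE // ltnW.
Qed.

End Exec.

(** * Marginal gains of a submodular function *)

Section Marginal.

Variables (R : realType) (N : finType) (f : {set N} -> R).
Hypothesis submod : submodular f.

Definition marginal (S : {set N}) (e : N) : R := f (e |: S) - f S.

(** Submodularity for [e |: S] and [T]: their union is [e |: T], and their intersection is [S]
    because [e] is not in [T]. *)
Lemma marginal_anti (S T : {set N}) e :
  S \subset T -> e \notin T -> marginal T e <= marginal S e.
Proof.
move=> ST eT; have := submod (e |: S) T.
rewrite -setUA (setUidPr ST) setIUl (setIidPl ST).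
rewrite (disjoint_setI0 (_ : [disjoint [set e] & T])) ?disjoints1 //.
rewrite set0U /marginal; lra.
Qed.

(** Insert the elements of [X :\: S] one at a time; each gains at most what it would gain over [S]
    alone. *)
Lemma le_sum_marginal (S X : {set N}) :
  f (X :|: S) - f S <= \sum_(e in X :\: S) marginal S e.
Proof.
have -> : X :|: S = (X :\: S) :|: S.
  by apply/setP=> x; rewrite !inE; case: (x \in S); rewrite ?orbT ?orbF.
have: [disjoint X :\: S & S] 
  by rewrite -setI_eq0; apply/eqP/setP=> x; rewrite !inE;
    case: (x \in S); rewrite ?andbF.
move: {X}(X :\: S) => Y; move: {2}#|Y| (erefl #|Y|) => n.
elim: n Y => [|n IH] Y cY dis.
  by rewrite (cards0_eq cY) big_set0 set0U subrr.
have [x xY] : exists x, x \in Y by apply/set0Pn; rewrite -card_gt0 cY.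
move: cY dis; rewrite -(setD1K xY) cardsU1 setD11 add1n => -[cX].
move: (Y :\ x) (setD11 x Y) cX => X /negbT xX cX.
rewrite -setI_eq0 setIUl setU_eq0 !setI_eq0 disjoints1 => /andP[xS dis].
rewrite big_setU1 //= -setUA.
have := IH _ cX dis; have := @marginal_anti S (X :|: S) x (subsetUr _ _).
rewrite inE negb_or xX xS => /(_ isT); rewrite /marginal; lra.
Qed.

End Marginal.

(** * Bases in p-set systems *)

Section PSystem.

Variables (R : realType) (N : finType) (I : {set {set N}}).
Hypothesis indep : independence_system I.

Lemma base_extension (A Y : {set N}) : A \subset Y -> A \in I ->
  exists2 B, is_base I B Y & A \subset B.
Proof.
move=> AY AI.
pose P (X : {set N}) := (X \subset Y) && (X \in I).
have [|B /maxsetP[/andP[BY BI] Bmax] AB] := @maxset_exists _ P A.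
  by rewrite /P AY.
exists B => //; apply/and3P; split=> //; apply/forall_inP=> x.
rewrite !inE => /andP[xB xY]; apply/negP=> xI.
have eqB : x |: B = B.
  by apply: Bmax; rewrite ?subsetUr // /P subUset sub1set xY BY.
by rewrite -eqB setU11 in xB.
Qed.

(** [S] is a base of [S :|: A] since everything in [A] is blocked, and [A] extends to another base
    of that set. *)
Lemma card_blocked (p : R) (S A : {set N}) :
  p_set_system p I -> S \in I -> A \in I ->
  (forall e, e \in A -> e \in S \/ e |: S \notin I) ->
  #|A|%:R <= p * #|S|%:R.
Proof.
move=> [_ psys] SI AI blocked.
have [B Bbase AB] := base_extension (subsetUr S A) AI.
apply: le_trans (psys _ _ _ Bbase _); first by rewrite ler_nat subset_leq_card.
apply/and3P; split=> //; first exact: subsetUl.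
by apply/forall_inP=> e; rewrite !inE => /andP[/negP eS /orP[//|/blocked[]]].
Qed.

End PSystem.

(** * The potential argument *)

Section Charging.

Variables (R : realType) (N : finType) (I : {set {set N}}) (f : {set N} -> R).
Variables (p eps : R) (O : {set N}).
Hypotheses (p_ge1 : 1 <= p) (psys : p_set_system p I) (submod : submodular f).
Hypotheses (f_ge0 : non_negative f) (eps_gt0 : 0 < eps) (OI : O \in I).

Local Notation marg := (marginal f).

(** An element that enters [T] uncharged is never added to [A], even if [S] blocks it later. So [A]
    depends on the history of the run and appears as an existential witness in [inv]. *)
Definition charged (A S T : {set N}) : Prop :=
  [/\ A \subset O,
      forall e, e \in A -> e \in S \/ e |: S \notin I
    & forall e, e \in O -> e \notin S :|: T -> e \notin A -> e |: S \in I].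

(* A is the set of elements of O blocked for S, together with those in S; the
   sum leaves out the unselected elements of O that may still join S. *)
Definition pot (tau : R) (A S T : {set N}) : R :=
  \sum_(e in (O :\: S) :&: (A :|: T)) marg S e
  + (1 + eps) * (tau * (p * #|S|%:R - #|A|%:R) - p * (f S - f set0)).

Definition capped_at (tau : R) (S : {set N}) (e : N) : Prop :=
  e |: S \in I -> marg S e <= tau.

Definition capped (tau : R) (S T : {set N}) : Prop :=
  forall e, e \notin S :|: T -> capped_at tau S e.

(** Each newly blocked element adds at most [(1 + eps) * tau] to the sum and uses one unit of
    capacity at that same price, so the two cancel. What remains is the capacity [p] opened by [s],
    the unit taken by [s] itself if it lies in [O], and the gain of [s]. *)
Lemma pot_add_own (tau : R) A S T s :
  charged A S T -> capped ((1 + eps) * tau) S T ->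
  s \notin S :|: T -> s |: S \in I ->
  exists2 A', charged A' (s |: S) T &
    pot tau A' (s |: S) T <= pot tau A S T
      + (1 + eps) * (tau * (p - (s \in O)%:R) - p * marg S s).
Proof.
move=> [AO Abl Acov] cap sST sI.
have sS : s \notin S by apply: contra sST; rewrite inE => ->.
have sT : s \notin T by apply: contra sST; rewrite inE orbC => ->.
have sA : s \notin A.
  by apply/negP=> /Abl [sS'|]; [rewrite sS' in sS | rewrite sI].
(* The newly charged elements: [s] itself if it is in [O], and the elements of [O] that are blocked
   by adding [s]. *)
pose B :=
  [set e in O :\: (S :|: T :|: A) | (e == s) || (e |: (s |: S) \notin I)].
have BP e : e \in B -> [/\ e \in O, e \notin S :|: T & e \notin A].
  rewrite !inE !negb_or => /andP[/andP[/andP[/andP[-> ->] ->] ->] _].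
  by [].
exists (A :|: B).
  split=> [|e|e eO eST eA].
  - by rewrite subUset AO; apply/subsetP=> e /BP[].
  - rewrite inE => /orP[/Abl[eS|eI]|]; first by left; rewrite inE eS orbT.
      right; apply: contra eI; apply: psys.1.2.
      by rewrite setUCA subsetUr.
    by rewrite inE => /andP[_ /orP[/eqP->|]]; [left; rewrite setU11 | right].
  - move: eST eA; rewrite !inE !negb_or => /andP[/andP[es eS] eT] /andP[eA].
    by rewrite eS eT eA eO (negPf es) /= negbK.
have dAB : [disjoint A & B].
  rewrite disjoint_sym disjoints_subset.
  by apply/subsetP=> e /BP[_ _ eA]; rewrite inE.
have cA : #|A :|: B| = (#|A| + ((s \in O) + #|B :\ s|))%N.
  have /eqP-> : #|A :|: B| == (#|A| + #|B|)%N by rewrite (leq_card_setU A B).2.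
  by rewrite (cardsD1 s B) !inE eqxx (negPf sS) (negPf sT) (negPf sA) andbT.
pose J := (O :\: S) :&: (A :|: T).
have sJ : s \notin J by rewrite !inE (negPf sA) (negPf sT) andbF.
have idx : (O :\: (s |: S)) :&: (A :|: B :|: T) = J :|: (B :\ s).
  apply/setP=> e; have [eB|eB] := boolP (e \in B).
    have [eO eST eA] := BP _ eB; move: eB eST eA.
    rewrite /J !(in_setI, in_setU, in_setD1, in_setD, in_set1).
    rewrite negb_or eO => -> /andP[].
    by move=> /negPf-> /negPf-> /negPf->; rewrite /= ?(orbF, andbF, andbT).
  rewrite /J !(in_setI, in_setU, in_setD1, in_setD, in_set1).
  rewrite (negPf eB) andbF !orbF.
  by case: eqVneq => //= ->; rewrite (negPf sA) (negPf sT) andbF.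
have dJB : [disjoint J & B :\ s].
  rewrite disjoint_sym disjoints_subset; apply/subsetP=> e.
  rewrite in_setD1 => /andP[_ /BP[_]].
  rewrite !inE !negb_or => /andP[_ /negPf->].
  by move=> /negPf->; rewrite andbF.
(* These elements could still join [S] before [s] did, so the cap applies to them; passing to
   [s |: S] only lowers their gains. *)
have sumB : \sum_(e in B :\ s) marg (s |: S) e
            <= (1 + eps) * tau * #|B :\ s|%:R.
  rewrite mulr_natr -sumr_const; apply: ler_sum => e.
  rewrite in_setD1 => /andP[es /BP[eO eST eA]].
  apply: le_trans (cap _ eST (Acov _ eO eST eA)).
  apply: marginal_anti => //; first exact: subsetUr.
  by rewrite in_setU1 negb_or es; apply: contra eST; rewrite inE => ->.
have sumJ : \sum_(e in J) marg (s |: S) e <= \sum_(e in J) marg S e.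
  apply: ler_sum => e eJ; apply: marginal_anti => //; first exact: subsetUr.
  rewrite in_setU1 negb_or; apply/andP; split.
    by apply: contraNneq sJ => <-.
  by move: eJ; rewrite !inE => /andP[/andP[]].
rewrite /pot idx (eq_bigl (mem [predU J & B :\ s])); last first.
  by move=> e; rewrite !inE.
rewrite bigU //= cardsU1 sS cA !natrD.
have -> : f (s |: S) = marg S s + f S by rewrite /marginal subrK.
rewrite -/J -[(nat_of_bool true)%:R]/1; move: (s \in O)%:R => o; lra.
Qed.

(** At most one term is new, the gain of [s] over [S]. It appears only if [s] is in [O] and
    uncharged, and then [s] may still join [S], so [d] bounds it. *)
Lemma pot_add_other (tau : R) A S T s (d : R) :
  charged A S T -> s \notin S :|: T -> 0 <= d ->
  (s |: S \in I -> marg S s <= d) ->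
  charged A S (s |: T) /\
  pot tau A S (s |: T) <= pot tau A S T + (s \in O)%:R * d.
Proof.
move=> [AO Abl Acov] sST d_ge0 sd; split.
  split=> // e eO eST eA; apply: Acov => //.
  by apply: contra eST; rewrite !inE => /orP[]->; rewrite ?orbT.
rewrite /pot addrAC lerD2r.
have [/andP[sO sA]|nsOA] := boolP ((s \in O) && (s \notin A)); last first.
  have -> : (O :\: S) :&: (A :|: (s |: T)) = (O :\: S) :&: (A :|: T).
    apply/setP=> e; rewrite !inE; case: eqVneq => //= ->.
    by move: nsOA; case: (s \in O); case: (s \in A); rewrite ?andbF.
  by rewrite lerDl mulr_ge0.
have -> : (O :\: S) :&: (A :|: (s |: T)) = s |: (O :\: S) :&: (A :|: T).
  apply/setP=> e; rewrite !inE; case: eqVneq => //= ->; rewrite orbT sO !andbT.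
  by apply: contra sST; rewrite inE => ->.
rewrite big_setU1 /=; last first.
  rewrite !inE (negPf sA); apply: contra sST; rewrite inE => /andP[_ /= ->].
  by rewrite orbT.
by rewrite addrC lerD2l sO mul1r; apply/sd/Acov.
Qed.

(** Only the sum of the two potentials is controlled: an element of [O] entering one set may raise
    the potential of the other by its gain, and the first potential pays for it. *)
Definition inv (tau : R) (S T : {set N}) : Prop :=
  [/\ S \in I, T \in I, [disjoint S & T] &
    exists A B, [/\ charged A S T, charged B T S
                  & pot tau A S T + pot tau B T S <= 0]].

Lemma inv_sym tau S T : inv tau S T -> inv tau T S.
Proof.
move=> [SI TI dST [A [B [cA cB AB]]]]; split; rewrite 1?disjoint_sym //.
by exists B, A; rewrite addrC.
Qed.

Lemma inv_init tau : inv tau set0 set0.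
Proof.
have e0 : set0 \in I by case: psys => -[].
have c0 : charged set0 set0 set0.
  split=> [|e|e eO _ _]; rewrite ?sub0set ?inE //.
  by apply: psys.1.2 OI; rewrite setU0 sub1set.
split; rewrite ?disjoints0 //; first by rewrite -setI_eq0 setI0.
exists set0, set0; split=> //; rewrite /pot setU0 setI0 big_set0 cards0.
by rewrite !(mulr0, subrr, addr0).
Qed.

Lemma inv_le (tau tau' : R) S T : tau' <= tau -> inv tau S T -> inv tau' S T.
Proof.
move=> le_tau [SI TI dST [A [B [cA cB AB]]]]; split=> //.
exists A, B; split=> //; apply: le_trans AB.
have mono U V C : U \in I -> charged C U V -> pot tau' C U V <= pot tau C U V.
  move=> UI [CO Cbl _]; have := card_blocked psys UI (psys.1.2 _ _ CO OI) Cbl.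
  rewrite /pot lerD2l ler_pM2l ?lerD2r; last by rewrite addr_gt0.
  by move=> le_card; apply: ler_wpM2r; rewrite ?subr_ge0.
by apply: lerD; apply: mono.
Qed.

Definition greedy (tau : R) (e : N) (S T : {set N}) : Prop :=
  [/\ e |: S \in I, tau <= marg S e
    & e |: T \in I -> marg T e <= marg S e].

Lemma inv_add (tau : R) S T s :
  0 <= tau -> inv tau S T -> capped ((1 + eps) * tau) S T ->
  s \notin S :|: T -> greedy tau s S T -> inv tau (s |: S) T.
Proof.
move=> tau_ge0 [SI TI dST [A [B [cA cB AB]]]] cap sST [sI tau_s sT_le].
split=> //.
  by rewrite -setI_eq0 setIUl setU_eq0 !setI_eq0 disjoints1 dST andbT;
    apply: contra sST; rewrite inE orbC => ->.
have [A' cA' potA'] := pot_add_own cA cap sST sI.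
have [|cB' potB'] := pot_add_other tau cB _ (le_trans tau_ge0 tau_s) sT_le.
  by rewrite setUC.
exists A', B; split=> //; apply: le_trans AB.
(* With [d] the gain of [s], the total change is at most [(1 + eps) * p * (tau - d)] if [s] is
   outside [O], and [(1 + eps) * (p - 1) * (tau - d) - eps * d] otherwise. *)
suff : (1 + eps) * (tau * (p - (s \in O)%:R) - p * marg S s)
       + (s \in O)%:R * marg S s <= 0 by move: potA' potB'; lra.
have d_ge0 := le_trans tau_ge0 tau_s.
move: (marg S s) tau_s d_ge0 => d tau_d d_ge0.
have c_ge0 q : 0 <= q -> 0 <= (1 + eps) * q * (d - tau).
  by move=> q_ge0; rewrite !mulr_ge0 ?subr_ge0 // ltW // addr_gt0.
have eps_d : 0 <= eps * d by rewrite mulr_ge0 // ltW.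
case: (s \in O) => /=.
  by have := c_ge0 (p - 1); rewrite subr_ge0 -[1%:R]/1 => /(_ p_ge1); lra.
by have := c_ge0 p (le_trans ler01 p_ge1); rewrite -[0%:R]/0; lra.
Qed.

(** Since [S] and [T] are disjoint, [O :|: S] and [O :|: T] meet exactly in [O]. Submodularity then
    reduces the bound to one estimate for each set. *)
Lemma inv_final (tau t : R) S T :
  0 <= tau -> 0 <= t -> inv tau S T -> capped t S T -> capped t T S ->
  f O <= (1 + (1 + eps) * p) * (f S + f T) + 2 * (#|O|%:R * t).
Proof.
move=> tau_ge0 t_ge0 [SI TI dST [A [B [cA cB AB]]]] capS capT.
(* Elements of [O :\: U] inside [C :|: V] are paid for by the potential; each remaining one can
   still join [U] and gains at most [t]. *)
have half U V C : U \in I -> charged C U V -> capped t U V ->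
    f (O :|: U) <= f U + (1 + eps) * p * f U + #|O|%:R * t + pot tau C U V.
  move=> UI [CO Cbl Ccov] cap.
  have cardC := card_blocked psys UI (psys.1.2 _ _ CO OI) Cbl.
  have := le_sum_marginal submod U O; rewrite (big_setID (C :|: V)) /=.
  have : \sum_(e in (O :\: U) :\: (C :|: V)) marg U e <= #|O|%:R * t.
    apply: (@le_trans _ _ (\sum_(e in (O :\: U) :\: (C :|: V)) t)).
      apply: ler_sum => e; rewrite !inE !negb_or.
      move=> /andP[/andP[eC eV] /andP[eU eO]].
      have eUV : e \notin U :|: V by rewrite inE negb_or eU.
      exact: (cap _ eUV (Ccov _ eO eUV eC)).
    rewrite sumr_const -[t *+ _]mulr_natl ler_wpM2r // ler_nat
      subset_leq_card //.
    by apply/subsetP=> e; rewrite !inE => /andP[_ /andP[]].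
  have : 0 <= (1 + eps) * (tau * (p * #|U|%:R - #|C|%:R)).
    by rewrite !mulr_ge0 ?subr_ge0 // ltW // addr_gt0.
  have : 0 <= (1 + eps) * p * f set0.
    by rewrite !mulr_ge0 // ltW // ?addr_gt0 //; apply: lt_le_trans p_ge1.
  rewrite /pot mulrBr; lra.
have := half _ _ _ SI cA capS; have := half _ _ _ TI cB capT.
have := submod (O :|: S) (O :|: T).
rewrite -setUIr (disjoint_setI0 dST) setU0.
have := f_ge0 ((O :|: S) :|: (O :|: T)); lra.
Qed.

End Charging.

(** * Specifications of the subroutines *)

Section Queries.

Variables (R : realType) (N : finType) (I : {set {set N}}) (f : {set N} -> R).

Local Notation marg := (marginal f).
Local Notation capped_at := (capped_at I f).
Local Notation exec := (exec f I).

Lemma max_singleton_spec :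
  exec (max_singleton R N) (fun m t =>
    [/\ (t <= 2 * #|N|)%N, 0 <= m,
        forall e, [set e] \in I -> f [set e] <= m
      & m = 0 \/ exists2 e, [set e] \in I & m = f [set e]]).
Proof.
(* Two queries are held in reserve for each element still to be visited. *)
pose P (s : seq N) (m : R) t :=
  [/\ (t + 2 * size s <= 2 * #|N|)%N, 0 <= m,
      forall e, e \notin s -> [set e] \in I -> f [set e] <= m
    & m = 0 \/ exists2 e, [set e] \in I & m = f [set e]].
apply: (@exec_weaken _ _ _ _ _ _ (P [::])).
  apply: exec_for_each => [e s m t [tle m_ge0 mmax m_att]|].
    apply/exec_bind/exec_test; case: ifP => eI; last first.
      apply: exec_ret; split=> //=; first by move: tle => /=; lia.
      move=> x xs xI; apply: mmax => //; rewrite inE negb_or xs andbT.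
      by apply: contraTneq xI => ->; rewrite eI.
    apply/exec_bind/exec_eval/exec_ret; split=> /=.
    - by move: tle => /=; lia.
    - by rewrite le_max m_ge0.
    - move=> x xs xI; rewrite le_max; have [->|xe] := eqVneq x e.
        by rewrite lexx orbT.
      by rewrite mmax // inE negb_or xe.
    - by rewrite maxEle; case: ifP => _; [right; exists e | exact: m_att].
  split=> //=; first by rewrite add0n -cardT.
    by move=> e; rewrite mem_enum.
  by left.
by move=> m t [tle m_ge0 mmax m_att]; split=> //; [lia | move=> e; exact: mmax].
Qed.

Lemma gain_spec e (S : {set N}) :
  exec (gain R e S) (fun d t => (t <= 3)%N /\
    d = if e |: S \in I then (marg S e)%:E else -oo%E).
Proof.
apply/exec_bind/exec_test; case: ifP => eI; last exact: exec_ret.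
by apply/exec_bind/exec_eval/exec_bind/exec_eval/exec_ret.
Qed.

Lemma examine_spec (tau : R) tie e (T : {set N} * {set N}) :
  exec (examine tau tie e T) (fun T' t => (t <= 6)%N /\
    [\/ T' = (e |: T.1, T.2) /\ greedy I f tau e T.1 T.2,
        T' = (T.1, e |: T.2) /\ greedy I f tau e T.2 T.1
      | [/\ T' = T, capped_at tau T.1 e & capped_at tau T.2 e]]).
Proof.
apply: exec_bind; apply: exec_weaken (gain_spec e T.1) _ => d1 t1 [t1le d1E].
apply: exec_bind; apply: exec_weaken (gain_spec e T.2) _ => d2 t2 [t2le d2E].
apply: exec_ret; split; first lia.
(* A real threshold is never below [-oo], so a successful comparison shows that [e] fits. *)
have fits d S : (if e |: S \in I then (marg S e)%:E else -oo%E) = d ->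
    (tau%:E <= d)%E -> [/\ e |: S \in I, tau <= marg S e & d = (marg S e)%:E].
  by case: ifP => // _ <-; rewrite ?leeNy_eq // lee_fin.
have cap d S : (if e |: S \in I then (marg S e)%:E else -oo%E) = d ->
    forall m, (d <= m%:E)%E -> capped_at m S e.
  by move=> <- m + eI; rewrite eI lee_fin.
set first := (_ || _); case: (boolP first) => [|nfirst].
  move=> /orP d21; have {}d21 : (d2 <= d1)%E.
    by case: d21 => [/ltW//|/andP[/eqP-> _]].
  case: ifP => [/(fits _ _ (esym d1E))[eI taud d1m]|/negbT].
    rewrite d1m in d21; constructor 1; split=> //; split=> //.
    exact: cap (esym d2E) _ d21.
  rewrite -ltNge => d1tau; constructor 3; split=> //.
    exact: cap (esym d1E) _ (ltW d1tau).
  exact: cap (esym d2E) _ (le_trans d21 (ltW d1tau)).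
have d12 : (d1 <= d2)%E by move: nfirst; rewrite negb_or -leNgt => /andP[].
case: ifP => [/(fits _ _ (esym d2E))[eI taud d2m]|/negbT].
  rewrite d2m in d12; constructor 2; split=> //; split=> //.
  exact: cap (esym d1E) _ d12.
rewrite -ltNge => d2tau; constructor 3; split=> //.
  exact: cap (esym d1E) _ (le_trans d12 (ltW d2tau)).
exact: cap (esym d2E) _ (ltW d2tau).
Qed.

End Queries.

(** * One round of the algorithm *)

Section Execution.

Variables (R : realType) (N : finType) (I : {set {set N}}) (f : {set N} -> R).
Variables (p eps : R) (O : {set N}).
Hypotheses (p_ge1 : 1 <= p) (psys : p_set_system p I) (submod : submodular f).
Hypotheses (eps_gt0 : 0 < eps) (OI : O \in I).

Local Notation marg := (marginal f).
Local Notation inv := (inv I f p eps O).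
Local Notation capped_at := (capped_at I f).
Local Notation exec := (exec f I).

(** Enlarging the set lowers gains, and by heredity it never makes an element addable again. *)
Lemma capped_at_add (tau : R) (S : {set N}) s e :
  e \notin s |: S -> capped_at tau S e -> capped_at tau (s |: S) e.
Proof.
move=> esS cap eI; apply: le_trans (marginal_anti submod (subsetUr _ _) esS) _.
by apply/cap/(psys.1.2 _ _ _ eI); rewrite setUCA subsetUr.
Qed.

(* The elements of s are still to be visited in the current round. *)
Definition scan_inv (tau : R) (s : seq N) (S T : {set N}) : Prop :=
  [/\ inv tau S T,
      forall e, e \notin S :|: T ->
        capped_at ((1 + eps) * tau) S e /\ capped_at ((1 + eps) * tau) T e,
      forall e, e \in s -> e \notin S :|: T
    & forall e, e \notin S :|: T -> e \notin s ->
        capped_at tau S e /\ capped_at tau T e].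

Lemma scan_inv_sym tau s S T : scan_inv tau s S T -> scan_inv tau s T S.
Proof.
move=> [/inv_sym iST cap rest done_]; split=> // e; rewrite setUC.
- by move=> /cap[].
- exact: rest.
- by move=> eST /(done_ _ eST)[].
Qed.

Lemma scan_inv_add (tau : R) e s S T :
  0 <= tau -> e \notin s -> scan_inv tau (e :: s) S T ->
  greedy I f tau e S T -> scan_inv tau s (e |: S) T.
Proof.
move=> tau_ge0 es [iST cap rest done_] gr.
have eST : e \notin S :|: T by apply: rest; rewrite mem_head.
have out x : x \notin e |: S :|: T ->
    [/\ x != e, x \notin e |: S & x \notin S :|: T].
  by rewrite !inE !negb_or => /andP[/andP[-> ->] ->].
split.
- by apply: inv_add gr => // x /cap[].
- by move=> x /out[_ xS /cap[capS capT]]; split=> //; apply: capped_at_add.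
- move=> x xs; rewrite -setUA inE negb_or rest ?inE ?xs ?orbT // andbT.
  by apply: contraNneq es => <-.
- move=> x /out[xe xS xST] xs.
  have [|capS capT] := done_ x xST; first by rewrite inE negb_or xe.
  by split=> //; apply: capped_at_add.
Qed.

(** A round sharpens the caps by a factor [1 + eps]: an element left unselected was rejected when
    visited, and later insertions preserve its cap. *)
Lemma round_spec (tau : R) tie (s : seq N) (T : {set N} * {set N}) :
  0 <= tau -> perm_eq s (enum N) -> inv tau T.1 T.2 ->
  (forall e, e \notin T.1 :|: T.2 ->
     capped_at ((1 + eps) * tau) T.1 e /\ capped_at ((1 + eps) * tau) T.2 e) ->
  exec (for_each [seq e <- s | e \notin T.1 :|: T.2] (examine tau tie) T)
    (fun T' t => [/\ (t <= 6 * #|N|)%N, inv tau T'.1 T'.2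
      & forall e, e \notin T'.1 :|: T'.2 ->
          capped_at tau T'.1 e /\ capped_at tau T'.2 e]).
Proof.
move=> tau_ge0 s_enum iT cap; set s0 := filter _ _.
pose P (s : seq N) (T : {set N} * {set N}) t :=
  [/\ (t + 6 * size s <= 6 * #|N|)%N, uniq s & scan_inv tau s T.1 T.2].
apply: (@exec_weaken _ _ _ _ _ _ (P [::])); last first.
  move=> T' t [tle _ [iT' _ _ done_]]; split=> //; first lia.
  by move=> e eT; apply: done_.
apply: exec_for_each => [e s' T' t [tle /= /andP[es us] sinv]|].
  apply: exec_weaken (examine_spec I f tau tie e T') _ => T'' u [ule cases].
  split=> //; first by move: tle => /=; lia.
  case: cases => [[-> gr]|[-> gr]|[-> cap1 cap2]] /=.
  - exact: scan_inv_add gr.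
  - by apply/scan_inv_sym/(scan_inv_add _ _ (scan_inv_sym sinv)).
  - case: sinv => iT' cap' rest done_; split=> //.
      by move=> x xs; apply: rest; rewrite inE xs orbT.
    move=> x xT xs; have [->|xe] := eqVneq x e; first by [].
    by apply: done_ => //; rewrite inE negb_or xe.
split.
- rewrite add0n leq_mul2l /= cardT -(perm_size s_enum) size_filter.
  exact: count_size.
- by rewrite filter_uniq // (perm_uniq s_enum) enum_uniq.
(* At the start, the cap at [tau] for visited elements is vacuous: every unselected element is still
   in the list. *)
- split=> // e; first by rewrite mem_filter => /andP[].
  by move=> eT; rewrite mem_filter eT (perm_mem s_enum) mem_enum.
Qed.

End Execution.

(** * Numerical estimates and the optimum *)

Lemma ln1D_ge_half (R : realType) (x : R) : 0 <= x <= 1 -> x / 2 <= ln (1 + x).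
Proof.
move=> /andP[x_ge0 x_le1]; have x1_gt0 : 0 < 1 + x by lra.
(* Applying [ln (1 + y) <= y] at [y = - (x / (1 + x))] gives [x / (1 + x) <= ln (1 + x)]. *)
have -> : 1 + x = (1 + - (x / (1 + x)))^-1 by field; lra.
have y_lt1 : x / (1 + x) < 1 by rewrite ltr_pdivrMr //; lra.
rewrite lnV; last by rewrite posrE; lra.
have := @le_ln1Dx R (- (x / (1 + x))); rewrite ltrN2 => /(_ y_lt1).
suff : x / 2 <= x / (1 + x) by lra.
by apply: ler_wpM2l => //; rewrite lef_pV2 ?posrE //; lra.
Qed.

(** Taking logarithms in the guard gives [(k - 1) * ln (1 + eps) < ln (r / eps)], and [ln (1 + eps)]
    is at least [eps / 2]. *)
Lemma round_bound (R : realType) (r k : nat) (eps m : R) :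
  (0 < r)%N -> 0 < eps < 1 -> 0 <= m ->
  eps * m / (r%:R * (1 + eps)) < m / (1 + eps) ^+ k ->
  k%:R < 1 + 2 * (ln (r%:R / eps) / eps).
Proof.
move=> r_gt0 /andP[e0 e1] m_ge0 guard.
have R0 : 0 < r%:R :> R by rewrite ltr0n.
have e10 : 0 < 1 + eps by lra.
have ek0 : 0 < (1 + eps) ^+ k by rewrite exprn_gt0.
(* For [m = 0] the guard would read [0 < 0]. *)
have m_gt0 : 0 < m.
  by rewrite lt_def m_ge0 andbT; apply: contraTneq guard => ->;
    rewrite mulr0 !mul0r ltxx.
have re0 : 0 < r%:R / eps by rewrite divr_gt0.
have lt_ek : (1 + eps) ^+ k < r%:R / eps * (1 + eps).
  move: guard; rewrite ltr_pdivrMr ?mulr_gt0 // mulrAC ltr_pdivlMr //.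
  rewrite -[eps * m * _]mulrA [eps * (m * _)]mulrCA. rewrite (ltr_pM2l m_gt0).
  by rewrite [in X in _ -> X]mulrAC ltr_pdivlMr // mulrC.
have L_ge0 : 0 <= ln (r%:R / eps).
  rewrite ln_ge0 // ler_pdivlMr // mul1r; apply: le_trans (ltW e1) _.
  by rewrite ler1n.
have half := @ln1D_ge_half R eps.
have {half} half : eps / 2 <= ln (1 + eps) by apply: half; lra.
have := lt_ek; rewrite -ltr_ln ?posrE ?mulr_gt0 ?invr_gt0 //
  lnXn // lnM ?posrE //.
rewrite -[ln _ *+ k]mulr_natr.
move: (ln (r%:R / eps)) L_ge0 (ln (1 + eps)) half => L L_ge0 l half lt_l.
rewrite -ltrBlDl mulrA ltr_pdivlMr //.
have [k_ge1|k_lt1] := lerP 0 (k%:R - 1 : R); nra.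
Qed.

Lemma opt_attained (R : realType) (N : finType) (I : {set {set N}})
    (f : {set N} -> R) :
  set0 \in I -> exists2 O, O \in I & opt I f = f O.
Proof.
move=> I0; rewrite /opt; elim/big_ind: _ => [|x y [O OI ->] [P PI ->]|O OI].
- by exists set0.
- by rewrite maxEle; case: ifP => _; [exists P | exists O].
- by exists O.
Qed.

Lemma le_opt (R : realType) (N : finType) (I : {set {set N}})
    (f : {set N} -> R) S : S \in I -> f S <= opt I f.
Proof. by move=> SI; apply: le_bigmax_cond. Qed.

(** The hypotheses give [(1 - 2 * eps) * F <= q * M] with [q = 2 * p + 2 + 2 * p * eps]; it then
    suffices that [(A - eps) * q <= 1 - 2 * eps]. *)
Lemma ratio_bound (R : realType) (p eps F M m : R) :
  1 <= p -> 0 < eps -> 0 <= F -> 0 <= M -> m <= F ->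
  F <= (1 + (1 + eps) * p) * (M + M) + 2 * (eps * m) ->
  (1 / (2 * p + 2) - eps) * F <= M.
Proof.
move=> p_ge1 e0 F_ge0 M_ge0 mF leF; set A := 1 / (2 * p + 2).
have Aq : A * (2 * p + 2) = 1 by rewrite /A; field; lra.
have A_gt0 : 0 < A by rewrite divr_gt0; lra.
have [Ae|Ae] := lerP (A - eps) 0.
  by apply: le_trans M_ge0; rewrite mulr_le0_ge0.
have pe : 0 <= p * eps by rewrite mulr_ge0; lra.
have q_gt0 : 0 < 2 * p + 2 + 2 * p * eps by lra.
rewrite -(ler_pM2r q_gt0) mulrAC.
have em : eps * m <= eps * F by rewrite ler_wpM2l // ltW.
apply: (@le_trans _ _ ((1 - 2 * eps) * F)); last by lra.
apply: ler_wpM2r => //.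
have : 0 <= p * eps * eps by rewrite mulr_ge0 // ltW.
have : 0 <= (p - 1) * eps by rewrite mulr_ge0 //; lra.
have : 0 <= A * eps by rewrite mulr_ge0 // ltW.
have -> : (A - eps) * (2 * p + 2 + 2 * p * eps) =
  A * (2 * p + 2) * (1 + eps) - 2 * (A * eps) - (2 * p + 2) * eps
  - 2 * (p * eps * eps) by ring.
rewrite Aq; lra.
Qed.

Theorem theorem3 :
  exists C : nat, forall (R : realType) (N : finType) (I : {set {set N}})
    (p : R) (f : {set N} -> R) (eps : R) (c : choices N),
  1 <= p ->
  p_set_system p I ->
  (1 <= rank I)%N ->
  submodular f -> non_negative f -> non_monotone f ->
  0 < eps < 1 ->
  valid_choices c ->
  exists (S : {set N}) (t : nat),
    [/\ returns f I (TwinGreedyFast (rank I) eps c) S t,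
        S \in I,
        (1 / (2 * p + 2) - eps) * opt I f <= f S
      & 2 <= (rank I)%:R / eps ->
        t%:R <= C%:R * (#|N|%:R / eps * ln ((rank I)%:R / eps))].
Proof.
(* With [n] the size of the ground set and [x = L / eps >= 1 / 2], the count is at most [2 * n + 6 *
   n * (2 + 2 * x) + 2 <= 16 * n + 12 * n * x <= 44 * n * x]. *)
exists 44%N => R N I p f eps c p_ge1 psys r_gt0 submod f_ge0 _ eps01 valid.
have /andP[e0 e1] := eps01; have e10 : 0 < 1 + eps by lra.
have [O OI optE] := opt_attained f psys.1.1.
have R0 : 0 < (rank I)%:R :> R by rewrite ltr0n.
have O_rank : (#|O| <= rank I)%N by apply: leq_bigmax_cond.
pose L := ln ((rank I)%:R / eps).
have L_ge0 : 0 <= L.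
  rewrite ln_ge0 // ler_pdivlMr // mul1r; apply: le_trans (ltW e1) _.
  by rewrite ler1n.
have B_ge0 : 0 <= 1 + 2 * (L / eps).
  by rewrite addr_ge0 // mulr_ge0 // divr_ge0 // ltW.
have [K K_gt K_le] : exists2 K : nat,
    forall k : nat, k%:R < 1 + 2 * (L / eps) -> (k < K)%N
    & K%:R <= 2 + 2 * (L / eps).
  exists (Num.truncn (1 + 2 * (L / eps))).+1 => [k k_lt|].
    by rewrite ltnS truncn_ge_nat // ltW.
  by have := truncn_le (1 + 2 * (L / eps)); rewrite B_ge0 -natr1; lra.
suff [S [t [rS [SI leS let_]]]] :
    exec f I (TwinGreedyFast (rank I) eps c) (fun S t =>
      [/\ S \in I, (1 / (2 * p + 2) - eps) * f O <= f S
        & (t <= 2 * #|N| + 6 * #|N| * K + 2)%N]).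
  exists S, t; split=> //; first by rewrite optE.
  move=> r_large; have N_gt0 : (0 < #|N|)%N.
    apply: leq_trans r_gt0 _; apply/bigmax_leqP => X _; exact: max_card.
  have L_half : 1 / 2 <= L.
    apply: le_trans (ln1D_ge_half _) _; first by lra.
    by rewrite ler_ln ?posrE ?divr_gt0 //; lra.
  have x_ge : 1 / 2 <= L / eps.
    by rewrite ler_pdivlMr //; apply: le_trans L_half; lra.
  have N_ge1 : 1 <= #|N|%:R :> R by rewrite ler1n.
  have : t%:R <= 2 * #|N|%:R + 6 * #|N|%:R * K%:R + 2 :> R.
    by rewrite -!natrM -!natrD ler_nat.
  rewrite -/L [_ / eps * L]mulrAC -[_ * L / eps]mulrA.
  move: (L / eps) (K%:R) (#|N|%:R) (t%:R) x_ge K_le N_ge1 =>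
    x k n u x_ge k_le n_ge1 le_u.
  have : 0 <= n * (2 + 2 * x - k) by rewrite mulr_ge0 //; lra.
  have : 0 <= n * (x - 1 / 2) by rewrite mulr_ge0 //; lra.
  lra.
apply: exec_bind; apply: exec_weaken (max_singleton_spec I f) _.
move=> m t0 [t0_le m_ge0 m_max m_att].
have m_opt : m <= f O.
  by case: m_att => [->|[e eI ->]]; rewrite ?f_ge0 // -optE le_opt.
pose tau k := m / (1 + eps) ^+ k.
have tau_ge0 k : 0 <= tau k by rewrite divr_ge0 // exprn_ge0 // ltW.
have tauS k : (1 + eps) * tau k.+1 = tau k.
  by rewrite /tau exprS; field; rewrite expf_neq0 lt0r_neq0.
(* The caps at [(1 + eps) * tau k] record rejection in the previous round, whose threshold was that
   value; before round 0 they follow from the maximality of [m]. *)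
pose P (st : nat * ({set N} * {set N})) t :=
  [/\ (st.1 <= K)%N, (t <= 6 * #|N| * st.1)%N,
      inv I f p eps O (tau st.1) st.2.1 st.2.2
    & forall e, e \notin st.2.1 :|: st.2.2 ->
        capped_at I f ((1 + eps) * tau st.1) st.2.1 e /\
        capped_at I f ((1 + eps) * tau st.1) st.2.2 e].
apply: exec_bind.
apply: (@exec_weaken _ _ _ _ _ _ (fun st t => P st t /\
    ~~ (eps * m / ((rank I)%:R * (1 + eps)) < tau st.1))).
  apply: (@exec_while _ _ _ _ _ _ _ _ (fun st => (K - st.1)%N)).
    move=> [k T] t [/= k_le t_le iT cap] guard.
    have k_lt := K_gt k (round_bound r_gt0 eps01 m_ge0 guard).
    apply: exec_bind.
    have round := round_spec p_ge1 psys submod e0 OI (tie c k) (tau_ge0 k).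
    apply: exec_weaken (round _ _ (valid k) iT cap) _ => //.
    move=> T' u [u_le iT' cap']; apply: exec_ret; split=> /=; last first.
      by rewrite ltn_sub2l.
    split=> //=; first by rewrite addn0 mulnS addnC leq_add.
      apply: (inv_le psys e0 OI) iT' => //.
      by rewrite -(tauS k) ler_peMl // lerDl ltW.
    by rewrite tauS.
  split=> //=; first by apply: inv_init.
  move=> e _; have cap0 : capped_at I f ((1 + eps) * tau 0%N) set0 e.
    rewrite /capped_at setU0 => eI; rewrite /marginal setU0 /tau expr0 divr1.
    apply: (@le_trans _ _ m).
      by have := m_max _ eI; have := f_ge0 set0; lra.
    by rewrite ler_peMl // lerDl ltW.
  by [].
move=> [k [S1 S2]] t1 [[/= k_le t1_le iS cap]]; rewrite -leNgt => tau_le.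
apply/exec_bind/exec_eval/exec_bind/exec_eval/exec_ret.
(* Failure of the guard bounds the last caps by [eps * m / r]; summed over at most [r] elements of
   [O], they cost at most [eps * m] per set. *)
have cap_le : (1 + eps) * tau k <= eps * m / (rank I)%:R.
  rewrite mulrC -ler_pdivlMr //; apply: le_trans tau_le _.
  by rewrite invfM mulrA.
have capped12 : capped I f (eps * m / (rank I)%:R) S1 S2.
  by move=> e /cap[cap1 _] /cap1/le_trans; apply.
have capped21 : capped I f (eps * m / (rank I)%:R) S2 S1.
  by move=> e; rewrite setUC => /cap[_ cap2] /cap2/le_trans; apply.
have leO := inv_final p_ge1 psys submod f_ge0 e0 OI (tau_ge0 k) _
  iS capped12 capped21.
have {}leO : f O <= (1 + (1 + eps) * p) * (f S1 + f S2) + 2 * (eps * m).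
  apply: le_trans (leO _) _; first by rewrite divr_ge0 ?mulr_ge0 // ltW.
  rewrite lerD2l ler_pM2l // mulrA ler_pdivrMr // mulrC ler_wpM2l ?ler_nat //.
  by rewrite mulr_ge0 // ltW.
have [S1I S2I _ _] := iS.
set first := (_ || _); have best : f S1 <= f (if first then S1 else S2) /\
    f S2 <= f (if first then S1 else S2).
  rewrite /first; case: (ltgtP (f S1) (f S2)) => /= [/ltW|/ltW|eqf] //.
  by case: (final_tie c); rewrite eqf.
split.
- by case: first {best}.
- have [le1 le2] := best; apply: (@ratio_bound _ _ _ _ _ m) => //.
  apply: le_trans leO _; rewrite lerD2r ler_wpM2l ?lerD //.
  by rewrite addr_ge0 // mulr_ge0 // ltW //; apply: lt_le_trans p_ge1.
- have := leq_trans t1_le (leq_mul (leqnn _) k_le).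
  by move=> t1_K; rewrite addnA leq_add // leq_add.
Qed.
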